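(* Let $m\ge 1$ and, for $l=0,\dots,m-1$, let $\mathcal R_l=\prod_{i=1}^N[a_i^{(l)},b_i^{(l)}]$ be an $N$-dimensional rectangle and $\psi_l:\mathcal R_l\to\mathbb R^N$ a continuous map. Put $\mathcal R_m=\mathcal R_0$. Assume there exists a finite (possibly empty) sequence of indexes $1\le i_1<i_2<\dots<i_k\le N$ such that, for every $l=0,\dots,m-1$, $\mathcal R_l$ $\psi_l$-covers $\mathcal R_{l+1}$ in $(i_1,\dots,i_k)$-direction along the paths. Then there exists $w\in\mathcal R_0$ such that $$\psi_l\circ\psi_{l-1}\circ\dots\circ\psi_0(w)\in\mathcal R_{l+1}\quad\text{for } l=0,1,\dots,m-2,$$ and $$\psi_{m-1}\circ\psi_{m-2}\circ\dots\circ\psi_0(w)=w.$$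
   Context: An $N$-dimensional rectangle is a product $\prod_{i=1}^N[a_i,b_i]\subseteq\mathbb R^N$ with $a_i<b_i$. Let $\mathcal R_1=\prod_{i=1}^N[a_i,b_i]$ and $\mathcal R_2=\prod_{i=1}^N[c_i,d_i]$ be two such rectangles, $\psi=(\psi_1,\dots,\psi_N):\mathcal R_1\to\mathbb R^N$ a continuous map and $J=\{i_1<\dots<i_k\}\subseteq\{1,\dots,N\}$. We say that $\mathcal R_1$ $\psi$-covers $\mathcal R_2$ in $(i_1,\dots,i_k)$-direction along the paths if: (i) for every $j\in J$ and every continuous path $\gamma=(\gamma_1,\dots,\gamma_N):[0,1]\to\mathcal R_1$ with $\gamma_j(0)=a_j$ and $\gamma_j(1)=b_j$, it holds that $\psi_j(\gamma([0,1]))\supseteq[c_j,d_j]$; (ii) for every $j\notin J$, $\psi_j(\mathcal R_1)\subseteq[c_j,d_j]$. *)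

(* Defs.v *)
From mathcomp Require Import all_boot all_order all_algebra.
From mathcomp Require Import all_classical all_reals all_analysis.

Set Implicit Arguments.
Unset Strict Implicit.
Unset Printing Implicit Defensive.

Import Order.TTheory GRing.Theory Num.Theory.
Import numFieldNormedType.Exports.

Local Open Scope classical_set_scope.
Local Open Scope ring_scope.

Definition rectangle (R : realType) (N : nat) (a b : 'rV[R]_N) : set 'rV[R]_N :=
  [set x | forall i : 'I_N, a 0 i <= x 0 i <= b 0 i].

(* A map defined on a rectangle is a total function of which only the values
   on that rectangle are used; likewise a path is a total function on R of
   which only the restriction to [0, 1] is used. *)
Definition path_in (R : realType) (N : nat) (A : set 'rV[R]_N)
    (g : R -> 'rV[R]_N) : Prop :=
  {within `[0, 1], continuous g} /\ (g @` `[0, 1] `<=` A).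

Definition covers_along_paths (R : realType) (N : nat)
    (a b c d : 'rV[R]_N) (psi : 'rV[R]_N -> 'rV[R]_N) (J : {set 'I_N}) : Prop :=
  (forall j : 'I_N, j \in J ->
     forall g : R -> 'rV[R]_N, path_in (rectangle a b) g ->
       g 0 0 j = a 0 j -> g 1 0 j = b 0 j ->
       `[c 0 j, d 0 j] `<=` [set psi (g t) 0 j | t in `[0, 1]]) /\
  (forall j : 'I_N, j \notin J ->
     [set psi x 0 j | x in rectangle a b] `<=` `[c 0 j, d 0 j]).

(* iter_maps psi n is psi_(n-1) o ... o psi_0, the identity when n = 0. *)
Fixpoint iter_maps (T : Type) (psi : nat -> T -> T) (n : nat) (w : T) : T :=
  if n is k.+1 then psi k (iter_maps psi k w) else w.

(* Main.v *)
(* Write a point of R_0 x ... x R_(m-1) as x = (x^0, ..., x^(m-1)); one has to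
   solve the cyclic system psi_l(x^l)_j = x^(l+1)_j.  For j in J, the solution
   set of equation (l, j) meets every path of the product that joins the two
   faces of the coordinate x^l_j; for j not in J, it meets those joining the
   faces of x^(l+1)_j.  So one closed set is attached to each coordinate of a
   cube, and it suffices that n closed sets in an n-cube, the k-th one meeting
   every path between the k-th pair of opposite faces, have a common point.
   Subdivide the cube and label a grid point, for each k, by whether it can be
   reached from the first k-th face off the k-th set: a cell on which every
   label takes both values meets all n sets, and compactness concludes.  Such a
   cell exists because the sum over all cells, modulo 2, of the cup product of
   the coboundaries of the labels telescopes to 1. *)
Require Import Defs.
From mathcomp Require Import all_boot all_order all_algebra.

Set Implicit Arguments.
Unset Strict Implicit.
Unset Printing Implicit Defensive.

Import Order.TTheory GRing.Theory Num.Theory.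

Local Open Scope ring_scope.

(** * Cup products of coboundaries modulo 2 *)

Section CupProduct.
Variables (I : finType) (V : zmodType) (e : I -> V) (lam : I -> V -> bool).

(* In the ring [bool] addition is [xor].  [cup ls D q] is the cup product of
   the coboundaries of [lam k], [k] in [ls], summed over the monotone edge
   paths issued from [q] that use each direction of [D] at most once. *)
Fixpoint cup (ls : seq I) (D : {set I}) (q : V) : bool :=
  if ls is k :: ls' then
    \sum_(j in D) (lam k (q + e j) + lam k q) * cup ls' (D :\ j) (q + e j)
  else 1.

Lemma addbool_eq0 (x y : bool) : x + y = 0 -> x = y.
Proof. by case: x; case: y. Qed.

(** The terms at [(i, j)] and [(j, i)] are equal, so they cancel modulo 2. *)
Lemma sum_offdiag_sym (D : {set I}) (F : I -> I -> bool) :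
  (forall i j, F i j = F j i) ->
  \sum_(i in D) \sum_(j in D :\ i) F i j = 0.
Proof.
move=> Fsym; have [n] := ubnP #|D|.
elim: n D => // n IH D; rewrite ltnS => leDn.
have [->|/set0Pn[x xD]] := eqVneq D set0; first by rewrite big_set0.
rewrite (big_setD1 x) //=.
under [X in _ + X]eq_bigr => i.
  rewrite !inE => /andP[ix iD]; rewrite (big_setD1 x) ?inE 1?eq_sym ?ix //=.
  rewrite setDDl setUC -setDDl; over.
rewrite big_split /= IH; last first.
  by rewrite (cardsD1 x) xD in leDn.
under [X in _ + (X + _)]eq_bigr => i _ do rewrite Fsym.
by rewrite addr0; apply: addbb.
Qed.

(* A cup product of coboundaries is a cocycle: this lets [cup_cons] rewrite
   each term as an exact difference, so that sums over a box telescope. *)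
Lemma cup_closed ls (D : {set I}) q :
  \sum_(j in D) cup ls (D :\ j) (q + e j) = \sum_(j in D) cup ls (D :\ j) q.
Proof.
elim: ls D q => [|k ls IH] D q //=; apply: addbool_eq0; rewrite -big_split /=.
have DC i j : D :\ j :\ i = D :\ i :\ j by rewrite !setDDl setUC.
pose f i j := lam k (q + e j) * cup ls (D :\ j :\ i) (q + e j).
(* The induction hypothesis moves the inner [cup] factor to the same point as its label. This leaves
   three double sums over pairs of distinct directions, each symmetric in [i] and [j]. *)
transitivity (
    \sum_(j in D) \sum_(i in D :\ j)
      lam k (q + e j + e i) * cup ls (D :\ j :\ i) (q + e j + e i)
  + \sum_(j in D) \sum_(i in D :\ j) (f i j + f j i)
  + \sum_(j in D) \sum_(i in D :\ j) lam k q * cup ls (D :\ j :\ i) q).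
  rewrite -!big_split /=; apply: eq_bigr => j jD.
  under eq_bigr => i _ do rewrite mulrDl.
  under [X in _ + X]eq_bigr => i _ do rewrite mulrDl.
  rewrite !big_split /= -2!mulr_sumr !IH !mulr_sumr -!addrA.
  congr (_ + (_ + (_ + _))); apply: eq_bigr => i _.
  by rewrite /f [D :\ i :\ j]DC.
rewrite sum_offdiag_sym => [|i j]; last by rewrite DC addrAC.
rewrite sum_offdiag_sym => [|i j]; last by rewrite addrC.
by rewrite sum_offdiag_sym // => i j; rewrite DC.
Qed.

Lemma cup_cons k ls (D : {set I}) q :
  cup (k :: ls) D q =
    \sum_(j in D) (lam k (q + e j) * cup ls (D :\ j) (q + e j) +
                   lam k q * cup ls (D :\ j) q).
Proof.
rewrite big_split /= -mulr_sumr -cup_closed mulr_sumr -big_split /=.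
by apply: eq_bigr => j _; rewrite mulrDl.
Qed.

End CupProduct.

(** * A cubical Sperner lemma *)

Section CubicalSperner.
Variables (I : finType) (p : nat).

(* Grid points live in the group (Z/(p+2))^I, so that translation by a basis
   vector is a bijection; the cube [0, p+1]^I is recovered by excluding the
   wrap-around at the coordinate value [ord_max = p+1]. *)
Local Notation grid := {ffun I -> 'I_p.+2}.

Definition gstep (j : I) : grid := [ffun i => (i == j)%:R].

Lemma gstep_same (q : grid) j : (q + gstep j) j = q j + 1.
Proof. by rewrite !ffunE eqxx. Qed.

Lemma gstep_other (q : grid) i j : i != j -> (q + gstep j) i = q i.
Proof. by move=> ij; rewrite !ffunE (negPf ij) addr0. Qed.

Lemma ord_max_add1 (x : 'I_p.+2) : (x + 1 == 0) = (x == ord_max).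
Proof.
rewrite addr_eq0; congr (x == _); apply/val_inj => /=.
by rewrite modn_small // subSS subn0 modn_small.
Qed.


(** Telescoping in direction [j]: translation by [gstep j] is a bijection that preserves [C], so
    interior terms occur twice and only the two faces survive. *)
Lemma sum_gstep (j : I) (C : pred grid) (f : grid -> bool) :
    (forall q, C (q + gstep j) = C q) ->
  \sum_(q | C q && (q j != ord_max)) (f (q + gstep j) + f q) =
  \sum_(q | C q && (q j == ord_max)) f q + \sum_(q | C q && (q j == 0)) f q.
Proof.
move=> CS; rewrite big_split /=.
rewrite (reindex_inj (addIr (- gstep j))) /=.
under eq_bigr do rewrite subrK.
under eq_bigl => q.
  rewrite -CS subrK -ord_max_add1 -gstep_same subrK; over.
have splitC (P : pred grid) : \sum_(q | C q) f q =
    \sum_(q | C q && P q) f q + \sum_(q | C q && ~~ P q) f q.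
  by rewrite (bigID P).
have := splitC (fun q : grid => q j == 0).
rewrite (splitC (fun q : grid => q j == ord_max)) /= => /eqP.
by do 4!case: (\sum_(q | _) _).
Qed.

Variable lam : I -> grid -> bool.
Hypothesis lam0 : forall k (q : grid), q k = 0 -> lam k q = false.
Hypothesis lam1 : forall k (q : grid), q k = ord_max -> lam k q = true.

(** Edge paths with directions in [D] never change coordinate [j], so they stay on a face where
    [lam j] is constant; its coboundary factor vanishes. *)
Lemma cup_face ls (D : {set I}) (q : grid) j :
    j \in ls -> j \notin D -> (q j == 0) || (q j == ord_max) ->
  cup gstep lam ls D q = 0.
Proof.
elim: ls D q => // k ls IH D q; rewrite inE => jls jD qj /=.
apply: big1 => i iD.
have ji : j != i by apply: contraNneq jD => ->.
have [jk|jk] := eqVneq j k.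
  suff -> : lam k (q + gstep i) = lam k q by rewrite [X in X * _]addbb mul0r.
  have qij := gstep_other q ji; rewrite -jk.
  by case/orP: qj => /eqP qj; [rewrite !lam0 ?qij | rewrite !lam1 ?qij].
rewrite IH ?mulr0 ?gstep_other //; first by rewrite (negPf jk) in jls.
by rewrite !inE (negPf jD) andbF.
Qed.

(** Induction on [ls], with the coordinates outside [ls] frozen at [ord_max]. After telescoping,
    directions other than [k] contribute nothing by [cup_face]. In direction [k] the face [q k = 0]
    has label 0, and the face [q k = ord_max] has label 1 and carries the sum for the shorter
    list. *)
Lemma sum_cup ls : uniq ls ->
  \sum_(q : grid | [forall i, (i \in ls) == (q i != ord_max)])
     cup gstep lam ls [set i in ls] q = 1.
Proof.
elim: ls => [_|k ls IH]; last rewrite cons_uniq => /andP[kls uls].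
  rewrite (big_pred1 [ffun=> ord_max]) // => q; apply/forallP/eqP => [H|-> i].
    apply/ffunP => i; rewrite ffunE; apply/eqP.
    by have := H i; case: (q i == ord_max).
  by rewrite ffunE eqxx.
set D := [set i in k :: ls].
under eq_bigr do rewrite cup_cons.
rewrite exchange_big /= (bigD1 k) ?inE ?eqxx //=.
pose C j (q : grid) :=
  [forall i, (i != j) ==> ((i \in k :: ls) == (q i != ord_max))].
have CE j (q : grid) : j \in k :: ls ->
    [forall i, (i \in k :: ls) == (q i != ord_max)] =
    C j q && (q j != ord_max).
  move=> jls; apply/forallP/andP => [H|[/forallP H qj] i].
    split; last by rewrite -(eqP (H j)).
    by apply/forallP => i; rewrite H implybT.
  by have [->|ij] := eqVneq i j; [rewrite jls qj | have := H i; rewrite ij].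
have CS j (q : grid) : C j (q + gstep j) = C j q.
  by apply: eq_forallb => i; case: eqVneq => //= ij; rewrite gstep_other.
under eq_bigl => q do rewrite (CE k) ?mem_head //.
rewrite (sum_gstep (fun q => lam k q * cup gstep lam ls (D :\ k) q) (CS k)) /=.
rewrite [X in _ + X + _]big1 ?addr0; last first.
  by move=> q /andP[_ /eqP qk]; rewrite lam0 // mul0r.
rewrite [X in _ + X]big1 ?addr0; last first.
  move=> j /andP[jD jk]; have jls : j \in k :: ls by rewrite inE in jD.
  have {}jls' : j \in ls by move: jls; rewrite inE (negPf jk).
  under eq_bigl => q do rewrite (CE j) //.
  rewrite (sum_gstep (fun q => lam k q * cup gstep lam ls (D :\ j) q) (CS j)) /=.
  rewrite !big1 ?addr0 // => q /andP[_ qj];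
    by rewrite (cup_face (j := j)) ?mulr0 ?inE ?eqxx ?qj ?orbT.
rewrite -[RHS](IH uls).
have -> : D :\ k = [set i in ls].
  by apply/setP => i; rewrite !inE; case: eqVneq => // ->; rewrite (negPf kls).
apply: eq_big => [q|q /andP[_ /eqP qk]]; last by rewrite lam1 // mul1r.
apply/andP/forallP => [[/forallP H /eqP qk] i|H].
  have := H i; rewrite inE; case: (eqVneq i k) => //= ->.
  by rewrite (negPf kls) qk eqxx.
split; last by have := H k; rewrite (negPf kls); case: (q k == ord_max).
by apply/forallP => i; apply/implyP => ik; rewrite inE (negPf ik) H.
Qed.

Definition in_cell (D : {set I}) (q u : grid) :=
  forall i, u i = q i \/ i \in D /\ u i = q i + 1.

(** Some edge path has all its factors nonzero: each label in [ls] changes along one of its edges,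
    and its vertices lie in the cell. *)
Lemma cup_neq0 ls (D : {set I}) q : cup gstep lam ls D q ->
  forall k, k \in ls -> exists u v,
    [/\ in_cell D q u, in_cell D q v & lam k u != lam k v].
Proof.
elim: ls D q => // l ls IH D q cupN k kls.
have [j jD /andP[lj cj]] : exists2 j, j \in D &
    (lam l (q + gstep j) + lam l q) && cup gstep lam ls (D :\ j) (q + gstep j).
  apply/exists_inP; apply: contraTT cupN => /exists_inPn N.
  by rewrite /= big1 // => j jD; apply/negbTE/N.
have stepP u : in_cell (D :\ j) (q + gstep j) u -> in_cell D q u.
  move=> uP i; have := uP i; have [->|ij] := eqVneq i j.
    by rewrite gstep_same !inE eqxx => -[->|[]//]; right.
  by rewrite gstep_other // !inE => -[->|[/andP[_ iD] ->]]; [left|right].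
move: kls; rewrite inE => /predU1P[->|kls].
  exists (q + gstep j), q; split => [||]; last by move: lj; case: lam; case: lam.
    by apply: stepP => i; left.
  by move=> i; left.
have [u [v [uP vP uv]]] := IH _ _ cj _ kls.
by exists u, v; split => //; apply: stepP.
Qed.

Lemma cubical_sperner : exists q : grid, (forall i, q i != ord_max) /\
  forall k, exists u v,
    [/\ in_cell setT q u, in_cell setT q v & lam k u != lam k v].
Proof.
have := sum_cup (enum_uniq I); have -> : [set i in enum I] = setT.
  by apply/setP => i; rewrite !inE mem_enum.
move=> S1; have [q /andP[/forallP qM cq]] : exists q : grid,
    [forall i, (i \in enum I) == (q i != ord_max)]
    && cup gstep lam (enum I) setT q.
  apply/existsP; apply: contraPT S1 => /existsPn N.
  by rewrite big1 // => q qP; apply/negbTE; have := N q; rewrite qP.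
exists q; split=> [i|k]; first by rewrite -(eqP (qM i)) mem_enum.
by apply: cup_neq0 cq _ _; rewrite mem_enum.
Qed.

End CubicalSperner.

From mathcomp Require Import all_classical all_reals all_analysis.
From mathcomp Require Import lra.

Import numFieldNormedType.Exports.

Local Open Scope classical_set_scope.
Local Open Scope ring_scope.

(** * Clamping, segments and continuous paths *)

Definition clamp (R : realType) (a b x : R) := Num.min (Num.max x a) b.

Lemma clamp_itv (R : realType) (a b x : R) : a <= b -> a <= clamp a b x <= b.
Proof. by move=> ab; rewrite /clamp le_min ge_min le_max !lexx ab !orbT. Qed.

Lemma clamp_id (R : realType) (a b x : R) : a <= x <= b -> clamp a b x = x.
Proof. by case/andP=> ax xb; rewrite /clamp max_l // min_l. Qed.

Lemma clamp_le (R : realType) (a b x : R) : a <= b -> x <= a -> clamp a b x = a.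
Proof. by move=> ab xa; rewrite /clamp max_r // min_l. Qed.

Lemma clamp_ge (R : realType) (a b x : R) : a <= b -> b <= x -> clamp a b x = b.
Proof.
by move=> ab bx; rewrite /clamp max_l ?min_r //; apply: le_trans bx.
Qed.

Lemma continuous_clamp (R : realType) (T : topologicalType) (a b : R)
    (f : T -> R) : continuous f -> continuous (fun t => clamp a b (f t)).
Proof.
move=> cf t; have ccst (c : R) : {for t, continuous (fun=> c : R^o)}.
  exact: cvg_cst.
exact: (continuous_min (continuous_max (cf t) (ccst a)) (ccst b)).
Qed.

Lemma segment_itv (R : realType) (a b x y t : R) :
  a <= x <= b -> a <= y <= b -> 0 <= t <= 1 -> a <= x + t * (y - x) <= b.
Proof.
move=> /andP[ax xb] /andP[ay yb] /andP[t0 t1].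
have h c d : 0 <= c -> 0 <= d -> 0 <= t * c + (1 - t) * d.
  by move=> c0 d0; rewrite addr_ge0 ?mulr_ge0 ?subr_ge0.
have := h (y - a) (x - a); have := h (b - y) (b - x).
by rewrite !subr_ge0 => /(_ yb xb) ? /(_ ay ax) ?; lra.
Qed.

Lemma segment_rVE (R : realType) n (x y : 'rV[R]_n) (t : R) i :
  (x + t *: (y - x)) 0 i = x 0 i + t * (y 0 i - x 0 i).
Proof. by rewrite !mxE. Qed.

Section ContinuousPaths.
Variables (R : realType) (V : normedModType R).

(* Paths are parametrised by the whole line and stay in [A] at all times, so
   that they can be concatenated without pasting. *)
Definition path_between (A : set V) (x y : V) := exists g : R -> V,
  [/\ continuous g, g 0 = x, g 1 = y & forall t, A (g t)].

Lemma path_between_trans (A : set V) x y z :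
  path_between A x y -> path_between A y z -> path_between A x z.
Proof.
move=> [g [cg g0 g1 Ag]] [h [ch h0 h1 Ah]].
pose u := clamp 0 (1 : R).
have c2 : continuous (fun t : R => 2 * t).
  by move=> t; apply: cvgM; [exact: cvg_cst | exact: cvg_id].
have cu : continuous (fun t : R => u (2 * t)) by exact: continuous_clamp.
have cv : continuous (fun t : R => u (2 * t - 1)).
  by apply: continuous_clamp => t; apply: cvgB; [exact: c2 | exact: cvg_cst].
have u0 t : t <= 0 -> u t = 0 by exact: clamp_le.
have u1 t : 1 <= t -> u t = 1 by exact: clamp_ge.
(* At each time one of the two summands rests at [y], so subtracting [y] leaves the other path. *)
exists (fun t => g (u (2 * t)) + h (u (2 * t - 1)) - y); split => [t|||t].
- apply: cvgB; last exact: cvg_cst.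
  apply: cvgD; first exact: (continuous_comp (cu t) (cg _)).
  exact: (continuous_comp (cv t) (ch _)).
- by rewrite !u0 ?h0 ?addrK //; lra.
- by rewrite !u1 ?g1 ?h1 1?addrC ?addKr //; lra.
- have [t2|t2] := leP (2 * t) 1.
    by rewrite (u0 (2 * t - 1)) ?h0 ?addrK //; lra.
  by rewrite (u1 (2 * t)) ?g1 1?addrC ?addKr //; lra.
Qed.

Lemma path_between_segment (A : set V) x y :
    (forall t : R, 0 <= t <= 1 -> A (x + t *: (y - x))) ->
  path_between A x y.
Proof.
move=> Axy; exists (fun t => x + clamp 0 1 t *: (y - x)); split => [t|||t].
- apply: cvgD; first exact: cvg_cst.
  apply: cvgZ; last exact: cvg_cst.
  by apply: continuous_clamp => s; exact: cvg_id.
- by rewrite clamp_id ?lexx ?ler01 // scale0r addr0.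
- by rewrite clamp_id ?lexx ?ler01 // scale1r addrC subrK.
- exact: Axy (clamp_itv _ ler01).
Qed.

End ContinuousPaths.

Lemma continuous_rV (R : realType) n (T : topologicalType) (f : T -> 'rV[R]_n) :
  (forall i, continuous (fun t => f t 0 i)) -> continuous f.
Proof.
move=> cf t; apply/cvg_ballP => e e0.
have : \forall s \near t, forall i, ball (f t 0 i) e (f s 0 i).
  by apply: filter_forall => i; move/cvg_ballP : (cf i t); apply.
by apply: filterS => s H; split=> // i j; rewrite ord1; exact: H.
Qed.

(** * Closed sets separating opposite faces of a cube *)

Section Cutting.
Variables (R : realType) (n : nat) (a b : 'rV[R]_n) (T : 'I_n -> set 'rV[R]_n).
Hypothesis ab : forall i, a 0 i < b 0 i.
Hypothesis T_cuts : forall k (g : R -> 'rV[R]_n), continuous g ->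
  (forall t, rectangle a b (g t)) -> g 0 0 k = a 0 k -> g 1 0 k = b 0 k ->
  exists t, T k (g t).

Definition grid_point p (q : {ffun 'I_n -> 'I_p.+2}) : 'rV[R]_n :=
  \row_i (a 0 i + (b 0 i - a 0 i) * (q i : nat)%:R / p.+1%:R).

Definition reachable (k : 'I_n) (x : 'rV[R]_n) := exists x0 : 'rV[R]_n,
  x0 0 k = a 0 k /\ path_between (rectangle a b `\` T k) x0 x.

Lemma grid_point_rectangle p (q : {ffun 'I_n -> 'I_p.+2}) :
  rectangle a b (grid_point q).
Proof.
move=> i; rewrite mxE -mulrA.
have q0 : 0 <= (q i : nat)%:R / p.+1%:R :> R by rewrite divr_ge0.
have q1 : (q i : nat)%:R / p.+1%:R <= 1 :> R.
  by rewrite ler_pdivrMr // mul1r ler_nat -ltnS.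
have d0 : 0 <= b 0 i - a 0 i by rewrite subr_ge0 ltW.
have := mulr_ge0 d0 q0; have := ler_piMr d0 q1.
by set z := _ * (_ / _); lra.
Qed.

Lemma cutting_cell p : exists x : 'rV[R]_n, rectangle a b x /\
  forall k, exists y : 'rV[R]_n, T k y /\
    forall i, `|x 0 i - y 0 i| <= (b 0 i - a 0 i) / p.+1%:R.
Proof.
(* The disjunct [q k == 0] is there for points of the first face lying in [T k], which are not
   reachable. *)
pose lam (k : 'I_n) (q : {ffun 'I_n -> 'I_p.+2}) :=
  ~~ ((q k == 0) || `[< reachable k (grid_point q) >]).
have lam0 k (q : {ffun 'I_n -> 'I_p.+2}) : q k = 0 -> lam k q = false.
  by move=> qk; rewrite /lam qk eqxx.
have lam1 k (q : {ffun 'I_n -> 'I_p.+2}) : q k = ord_max -> lam k q = true.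
  move=> qk; rewrite /lam qk /=.
  apply/asboolPn => -[x0 [x0k [g [cg g0 g1 gT]]]].
  have [|||t] := T_cuts (k := k) cg; last by have [] := gT t.
  - by move=> t; have [] := gT t.
  - by rewrite g0.
  - by rewrite g1 mxE qk /= mulfK ?pnatr_eq0 // addrC subrK.
have [q [qM qk]] := cubical_sperner lam0 lam1.
exists (grid_point q); split; first exact: grid_point_rectangle.
have cellP u : in_cell finset.setT q u ->
    forall i, grid_point q 0 i <= grid_point u 0 i <=
      grid_point q 0 i + (b 0 i - a 0 i) / p.+1%:R.
  move=> uP i; rewrite !mxE.
  have d0 : 0 <= (b 0 i - a 0 i) / p.+1%:R by rewrite divr_ge0 // subr_ge0 ltW.
  case: (uP i) => [->|[_ ->]]; first by rewrite lexx lerDl.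
  have -> : (nat_of_ord (q i + 1)%R)%:R = (q i : nat)%:R + 1 :> R.
    (* As [q i] is not [ord_max], adding 1 does not wrap around. *)
    have qi : (q i < p.+1)%N.
      have := ltn_ord (q i); rewrite ltnS leq_eqVlt.
      by rewrite -[_ == _]/(q i == ord_max) (negPf (qM i)).
    by rewrite /= [(1 %% _)%N]modn_small // modn_small ?addn1 -?natr1.
  move: d0; set d := b 0 i - a 0 i => d0.
  by rewrite mulrDr mulr1 mulrDl addrA lexx lerDl d0.
move=> k; have [u [v [uP vP uv]]] : exists u v,
    [/\ in_cell finset.setT q u, in_cell finset.setT q v &
        ~~ lam k u /\ lam k v].
  have [u [v [uP vP]]] := qk k.
  case lu: (lam k u); case lv: (lam k v) => // _; [exists v, u|exists u, v];
    by split => //; rewrite lu lv.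
case: uv => lu /norP[_ /asboolPn nv].
(* If the segment from [u] to [v] missed [T k], it would make [v] reachable, either from [u] itself
   on the first face or by prolonging a path to [u]. *)
have [s [s01 Ts]] : exists s : R, 0 <= s <= 1 /\
    T k (grid_point u + s *: (grid_point v - grid_point u)).
  apply: contrapT => nT; apply: nv.
  have uv_path :
      path_between (rectangle a b `\` T k) (grid_point u) (grid_point v).
    apply: path_between_segment => t t01.
    split; last by move=> Tt; apply: nT; exists t.
    move=> i; rewrite segment_rVE.
    have := grid_point_rectangle v i; have := grid_point_rectangle u i.
    by move=> ui vi; apply: segment_itv.
  move: lu; rewrite negbK => /orP[/eqP uk|/asboolP[x0 [x0k ux]]].
    by exists (grid_point u); split => //; rewrite mxE uk mulr0 mul0r addr0.
  by exists x0; split => //; apply: path_between_trans uv_path.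
exists (grid_point u + s *: (grid_point v - grid_point u)); split => // i.
have := segment_itv (cellP u uP i) (cellP v vP i) s01.
rewrite segment_rVE.
set d := (b 0 i - a 0 i) / _; rewrite ler_norml.
by set z := _ + _ * _ => /andP[? ?]; apply/andP; split; lra.
Qed.

Hypothesis T_closed : forall k, closed (T k).

(** The points given by [cutting_cell] have a cluster point; every [T k] comes arbitrarily close to
    it and is closed. *)
Lemma cutting_sets_meet : exists x, rectangle a b x /\ forall k, T k x.
Proof.
have [x xP] := choice cutting_cell.
have rect_compact : compact (rectangle a b).
  have -> : rectangle a b =
      [set v | forall i, `[a 0 i, b 0 i]%classic (v ord0 i)].
    by apply/seteqP; split => v vP i; have := vP i; rewrite /= in_itv.
  apply: (@rV_compact _ _ (fun i => `[a 0 i, b 0 i]%classic)) => i.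
  exact: segment_compact.
have xR : (x @ \oo) (rectangle a b) by exists 0%N => // p _; have [] := xP p.
have [c [cab cx]] := rect_compact _ _ xR; exists c; split => // k.
apply: T_closed => B /nbhs_ballP[e e0 cB].
pose M := \sum_i (b 0 i - a 0 i).
have MP i : b 0 i - a 0 i <= M.
  rewrite /M (bigD1 i) //= lerDl sumr_ge0 // => j _; by rewrite subr_ge0 ltW.
(* For [p >= P] every side of a cell is shorter than [e / 2]. *)
pose P := Num.trunc (M / (e / 2)).
have [] := cx [set x p | p in [set p | (P <= p)%N]] (ball c (e / 2)).
- by exists P => // p /= Pp; exists p.
- by apply: nbhsx_ballx; rewrite divr_gt0.
move=> _ [[p /= Pp <-] cxp].
have [y [Ty yx]] := (xP p).2 k.
exists y; split => //; apply: cB.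
rewrite [e]splitr; apply: ball_triangle cxp _.
split=> [|i j]; first by rewrite divr_gt0.
rewrite ord1 /ball /=; apply: le_lt_trans (yx j) _.
have pP : M / (e / 2) < p.+1%:R.
  by apply: lt_le_trans (truncnS_gt _) _; rewrite ler_nat ltnS.
rewrite ltr_pdivrMr // mulrC -ltr_pdivrMr ?divr_gt0 //.
by apply: le_lt_trans pP; rewrite ler_pM2r ?invr_gt0 ?divr_gt0.
Qed.

End Cutting.

(** * Sign changes, extension by clamping, and blocks of a point of a product *)

Lemma continuous_sign_change (R : realType) (h : R -> R) (s t : R) :
  continuous h -> h s <= 0 -> 0 <= h t -> exists r, h r = 0.
Proof.
move=> ch hs ht.
have [st|/ltW ts] := leP s t.
  have [||r _ hr] := @IVT _ h s t 0 st; last by exists r.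
    exact: continuous_subspaceT.
  by rewrite ge_min hs le_max ht orbT.
have [||r _ hr] := @IVT _ h t s 0 ts; last by exists r.
  exact: continuous_subspaceT.
by rewrite ge_min hs le_max ht orbT.
Qed.

Definition clamp_rV (R : realType) n (a b x : 'rV[R]_n) : 'rV[R]_n :=
  \row_i clamp (a 0 i) (b 0 i) (x 0 i).

(** Clamping retracts the space onto the rectangle, so this extends [f] continuously to the whole
    space. *)
Lemma continuous_comp_clamp_rV (R : realType) n (T : topologicalType)
    (a b : 'rV[R]_n) (f : 'rV[R]_n -> T) :
    (forall i, a 0 i <= b 0 i) -> {within rectangle a b, continuous f} ->
  continuous (f \o clamp_rV a b).
Proof.
move=> ab /subspace_continuousP cf x.
have rx y : rectangle a b (clamp_rV a b y) by move=> i; rewrite mxE clamp_itv.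
apply: (@cvg_comp _ _ _ _ _ _ (within (rectangle a b) (nbhs (clamp_rV a b x)))).
  have cc : continuous (clamp_rV a b).
    apply: continuous_rV => i; under eq_fun do rewrite mxE.
    by apply: continuous_clamp; exact: coord_continuous.
  by move=> B /= WB; apply: (@filterS _ (nbhs x)) (cc x _ WB) => y; apply.
exact: cf.
Qed.

Lemma clamp_rV_id (R : realType) n (a b x : 'rV[R]_n) :
  rectangle a b x -> clamp_rV a b x = x.
Proof. by move=> rx; apply/rowP => i; rewrite mxE clamp_id. Qed.

Definition mxvec_pair m n (k : 'I_(m * n)) : 'I_m * 'I_n :=
  enum_val (cast_ord (esym (mxvec_cast m n)) k).

Lemma mxvec_indexK m n (l : 'I_m) (j : 'I_n) :
  mxvec_pair (mxvec_index l j) = (l, j).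
Proof. by rewrite /mxvec_pair /mxvec_index cast_ordK enum_rankK. Qed.

Definition slice (R : Type) m n (x : 'rV[R]_(m * n)) (l : 'I_m) : 'rV[R]_n :=
  row l (vec_mx x).

Lemma sliceE (R : Type) m n (x : 'rV[R]_(m * n)) (l : 'I_m) j :
  slice x l 0 j = x 0 (mxvec_index l j).
Proof. by rewrite !mxE. Qed.

Lemma continuous_slice (R : realType) m n (l : 'I_m) :
  continuous (fun x : 'rV[R]_(m * n) => slice x l).
Proof.
apply: continuous_rV => j; under eq_fun do rewrite sliceE.
exact: coord_continuous.
Qed.

(** * The cyclic system of equations *)

Section CyclicSystem.
Variables (R : realType) (m N : nat) (a b : 'I_m -> 'rV[R]_N).
Variables (psi : 'I_m -> 'rV[R]_N -> 'rV[R]_N) (J : {set 'I_N}).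
Hypothesis ab : forall l i, a l 0 i < b l 0 i.
Hypothesis psi_cont : forall l,
  {within rectangle (a l) (b l), continuous (psi l)}.
Hypothesis cov : forall l, covers_along_paths (a l) (b l)
  (a (ordS l)) (b (ordS l)) (psi l) J.

Let stack (c : 'I_m -> 'rV[R]_N) : 'rV[R]_(m * N) :=
  mxvec (\matrix_(l, j) c l 0 j).

Let stackE c l j : stack c 0 (mxvec_index l j) = c l 0 j.
Proof. by rewrite mxvecE mxE. Qed.

Let defect l j (x : 'rV[R]_(m * N)) : R :=
  psi l (clamp_rV (a l) (b l) (slice x l)) 0 j - slice x (ordS l) 0 j.

Let continuous_defect l j : continuous (defect l j).
Proof.
have c1 : continuous (psi l \o clamp_rV (a l) (b l)).
  by apply: continuous_comp_clamp_rV => // i; exact: ltW.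
move=> x; have c2 := continuous_comp (@continuous_slice R m N l x) (c1 _).
have c3 := continuous_comp c2 (@coord_continuous _ _ _ 0 j _).
have c4 := continuous_comp (@continuous_slice R m N (ordS l) x)
  (@coord_continuous _ _ _ 0 j _).
exact: (continuousB c3 c4).
Qed.

(** The defect changes sign along [g]. For [j] in [J], the covering makes [psi l] attain both ends
    of the range of the next coordinate. Otherwise the image coordinate stays between the ends while
    coordinate [(l, j)] runs from one to the other. *)
Let equation_cuts l j (l' := if j \in J then l else ord_pred l)
    (g : R -> 'rV[R]_(m * N)) :
    continuous g -> (forall t, rectangle (stack a) (stack b) (g t)) ->
    g 0 0 (mxvec_index l j) = stack a 0 (mxvec_index l j) ->
    g 1 0 (mxvec_index l j) = stack b 0 (mxvec_index l j) ->
  exists t, defect l' j (g t) = 0.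
Proof.
move=> cg rg g0 g1; rewrite /l' => {l'}.
have rs t i : rectangle (a i) (b i) (slice (g t) i).
  by move=> k; rewrite sliceE -!stackE; exact: rg.
have cd i : continuous (fun t => defect i j (g t)).
  by move=> t; apply: continuous_comp (cg t) _; exact: continuous_defect.
have dE i t : defect i j (g t) =
    psi i (slice (g t) i) 0 j - slice (g t) (ordS i) 0 j.
  by rewrite /defect clamp_rV_id.
case: ifP => jJ; last first.
  have H t := (cov (ord_pred l)).2 j (negbT jJ) _ (imageP _ (rs t _)).
  apply: (continuous_sign_change (s := 1) (t := 0)) => //.
    have /= := H 1; rewrite in_itv /= ord_predK dE ord_predK subr_le0 => /andP[_].
    by rewrite sliceE g1 stackE.
  have /= := H 0; rewrite in_itv /= ord_predK dE ord_predK subr_ge0 => /andP[+ _].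
  by rewrite sliceE g0 stackE.
have gp : path_in (rectangle (a l) (b l)) (fun t => slice (g t) l).
  split; last by move=> _ [t _ <-].
  apply: continuous_subspaceT => t.
  exact: (continuous_comp (cg t) (@continuous_slice _ _ _ _ _)).
have := (cov l).1 j jJ _ gp; rewrite !sliceE g0 g1 !stackE => /(_ erefl erefl) H.
have abS := ltW (ab (ordS l) j).
have [s _ sE] := H (a (ordS l) 0 j) ltac:(by rewrite /= in_itv /= lexx abS).
have [t _ tE] := H (b (ordS l) 0 j) ltac:(by rewrite /= in_itv /= lexx abS).
apply: (continuous_sign_change (s := s) (t := t)) => //; rewrite dE.
  by rewrite subr_le0 sE; have /andP[] := rs s (ordS l) j.
by rewrite subr_ge0 tE; have /andP[] := rs t (ordS l) j.
Qed.

Lemma cyclic_system_solvable : exists x : 'I_m -> 'rV[R]_N, forall l,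
  rectangle (a l) (b l) (x l) /\ psi l (x l) = x (ordS l).
Proof.
pose T (k : 'I_(m * N)) := let: (l, j) := mxvec_pair k in
  [set x | defect (if j \in J then l else ord_pred l) j x = 0].
have [||| x [rx Tx]] := @cutting_sets_meet R (m * N) (stack a) (stack b) T.
- by move=> k; case/mxvec_indexP: k => l j; rewrite !stackE.
- move=> k; rewrite /T; case/mxvec_indexP: k => l j g cg rg g0 g1.
  by rewrite mxvec_indexK; exact: equation_cuts.
- move=> k; rewrite /T; case: mxvec_pair => l j.
  apply: (@preimage_closed _ _ (defect _ j) [set 0]); last exact: closed_eq.
  by move=> y _; exact: continuous_defect.
have rs l : rectangle (a l) (b l) (slice x l).
  by move=> k; rewrite sliceE -!stackE; exact: rx.
exists (slice x) => l; split => //; apply/rowP => j; apply/eqP; rewrite -subr_eq0.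
(* This inverts the matching: it is the coordinate to which equation [(l, j)] is attached. *)
have := Tx (mxvec_index (if j \in J then l else ordS l) j).
rewrite /T mxvec_indexK /= /defect.
rewrite (_ : (if _ then _ else _) = l); last first.
  by case: (j \in J); rewrite ?ordSK.
by rewrite clamp_rV_id // => ->.
Qed.

End CyclicSystem.

(** * From the cyclic system to a periodic point *)

Theorem theorem3p4 (R : realType) (N m : nat)
    (a b : nat -> 'rV[R]_N) (psi : nat -> 'rV[R]_N -> 'rV[R]_N)
    (hN : (1 <= N)%N) (hm : (1 <= m)%N)
    (hab : forall l : nat, (l < m)%N -> forall i : 'I_N, a l 0 i < b l 0 i)
    (hpsi : forall l : nat, (l < m)%N ->
       {within rectangle (a l) (b l), continuous (psi l)})
    (ham : a m = a 0%N) (hbm : b m = b 0%N)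
    (hcov : exists J : {set 'I_N}, forall l : nat, (l < m)%N ->
       covers_along_paths (a l) (b l) (a l.+1) (b l.+1) (psi l) J) :
  exists w : 'rV[R]_N,
    [/\ rectangle (a 0%N) (b 0%N) w,
        forall l : nat, (l.+1 < m)%N ->
          rectangle (a l.+1) (b l.+1) (iter_maps psi l.+1 w) &
        iter_maps psi m w = w].
Proof.
have [J cov] := hcov.
(* [ordS] is the successor modulo [m]; at the last index, [c m = c 0] closes the cycle. *)
have succE (T : Type) (c : nat -> T) :
    c m = c 0%N -> forall l : 'I_m, c (ordS l) = c l.+1.
  move=> cm l; rewrite /=; have := ltn_ord l.
  by rewrite leq_eqVlt => /predU1P[->|lm]; [rewrite modnn cm | rewrite modn_small].
have [||| x xP] := @cyclic_system_solvable R m N a b psi J.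
- by move=> l; exact: hab.
- by move=> l; exact: hpsi.
- by move=> l; rewrite !succE //; exact: cov.
have iterE l (lm : (l < m)%N) :
    iter_maps psi l (x (Ordinal hm)) = x (Ordinal lm).
  elim: l lm => [|l IH] lm /=; first by congr x; exact: val_inj.
  rewrite (IH (ltnW lm)); have [_ ->] := xP (Ordinal (ltnW lm)).
  by congr x; apply: val_inj; rewrite /= modn_small.
exists (x (Ordinal hm)); split.
- exact: (xP (Ordinal hm)).1.
- by move=> l lm; rewrite iterE; exact: (xP (Ordinal lm)).1.
- have pm : (m.-1 < m)%N by rewrite prednK.
  suff : iter_maps psi m.-1.+1 (x (Ordinal hm)) = x (Ordinal hm).
    by rewrite prednK.
  rewrite /= (iterE _ pm); have [_ ->] := xP (Ordinal pm).
  by congr x; apply: val_inj; rewrite /= prednK // modnn.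
Qed.
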